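(* Let $p$ be a prime and $n$ a positive integer. Two finite abelian $p$-groups $G$ and $H$ of order $p^n$ are isomorphic if and only if they have the same product of element orders, i.e. $G\cong H$ if and only if $\psi'(G)=\psi'(H)$.
   Context: For a finite group $G$, $\psi'(G)=\prod_{x\in G}o(x)$ denotes the product of the orders of all elements of $G$, where $o(x)$ is the order of $x\in G$. *)

(* Defs.v *)
From mathcomp Require Import all_boot all_fingroup all_solvable.

Set Implicit Arguments.
Unset Strict Implicit.
Unset Printing Implicit Defensive.

Definition psi' (gT : finGroupType) (A : {set gT}) : nat :=
  (\prod_(x in A) #[x]%g)%N.

(* Main.v *)
(** Let [p ^ c k] be the number of solutions of [x ^ (p ^ k) = 1] in an abelian
    group [G] of order [p ^ n]. Summing [logn p #[x]] over [x] shows that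
    [psi' G] determines [\sum_(k < N) p ^ c k] for [N >= n]. The sequence [c] is
    strictly increasing until it reaches [n], so at the first index where two
    such sequences differ, the two sums are distinguished modulo the power of
    [p] following the smaller term. Hence [psi' G] determines [c], whose
    increments count the cyclic factors of order greater than [p ^ k]. *)
Require Import Defs.
From mathcomp Require Import all_boot all_fingroup all_solvable.

Set Implicit Arguments.
Unset Strict Implicit.
Unset Printing Implicit Defensive.

Definition strict_until (n : nat) (c : nat -> nat) :=
  forall k, [/\ c k <= n, c k <= c k.+1 & c k < n -> c k < c k.+1].

Lemma strict_until_shift n c : strict_until n c -> strict_until n (c \o succn).
Proof. by move=> hc k; apply: hc. Qed.

Lemma strict_until_leq n c k : strict_until n c -> c 0 <= c k.
Proof.
move=> hc; elim: k => // k /leq_trans; apply; by case: (hc k).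
Qed.

(** Work modulo [p ^ (c 0).+1]: the sum for [d] vanishes. Since [c 0 < d 0 <= n], [c] has not yet
    reached [n], so its later terms exceed [c 0] and only [p ^ c 0] survives. *)
Lemma sum_expn_strict_until_ltF p n c d N :
  1 < p -> strict_until n c -> strict_until n d -> c 0 < d 0 ->
  \sum_(k < N.+1) p ^ c k <> \sum_(k < N.+1) p ^ d k.
Proof.
move=> p_gt1 hc hd lt_cd eq_sum.
have p_gt0 : 0 < p by apply: ltnW.
have dvd_d : p ^ (c 0).+1 %| \sum_(k < N.+1) p ^ d k.
  apply: dvdn_sum => k _; apply: dvdn_exp2l.
  exact: leq_trans lt_cd (strict_until_leq k hd).
have dvd_c : p ^ (c 0).+1 %| \sum_(k < N) p ^ c (lift ord0 k).
  apply: dvdn_sum => k _; apply: dvdn_exp2l.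
  have [[_ _ lt_c01] [le_dn _ _]] := (hc 0, hd 0).
  apply: leq_trans (lt_c01 (leq_trans lt_cd le_dn)) _.
  exact: (strict_until_leq k (strict_until_shift hc)).
move: dvd_d; rewrite -eq_sum big_ord_recl (dvdn_addl _ dvd_c).
by rewrite dvdn_Pexp2l // ltnn.
Qed.

Lemma sum_expn_strict_until_inj p n c d N :
  1 < p -> strict_until n c -> strict_until n d ->
  \sum_(k < N) p ^ c k = \sum_(k < N) p ^ d k -> forall k, k < N -> c k = d k.
Proof.
move=> p_gt1; elim: N c d => // N IHN c d hc hd eq_sum.
have eq0 : c 0 = d 0.
  have [lt_cd|lt_dc|//] := ltngtP (c 0) (d 0).
    by case: (sum_expn_strict_until_ltF p_gt1 hc hd lt_cd eq_sum).
  by case: (sum_expn_strict_until_ltF p_gt1 hd hc lt_dc (esym eq_sum)).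
case=> // k; rewrite ltnS; apply: (IHN (c \o succn) (d \o succn)).
- exact: strict_until_shift.
- exact: strict_until_shift.
by move: eq_sum; rewrite !big_ord_recl eq0 => /addnI.
Qed.

Lemma sum_leq_ord a N : a <= N -> a + \sum_(k < N) (a <= k) = N.
Proof.
elim: N => [|N IHN]; first by rewrite leqn0 => /eqP->; rewrite big_ord0.
rewrite leq_eqVlt ltnS => /predU1P[-> | le_aN].
  by rewrite big1 ?addn0 // => k _; rewrite leqNgt ltn_ord.
by rewrite big_ord_recr /= le_aN addnA IHN // addn1.
Qed.

(** The multiplicity of [p ^ k.+1] is the difference of the counts at [k] and [k.+1]. Entries equal
    to 1 are invisible to these counts, hence the bounds [m > 1]. *)
Lemma perm_eq_count_logn p (s t : seq nat) :
  prime p -> all (pnat p) s -> all (pnat p) t -> all [pred m | m > 1] s ->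
  all [pred m | m > 1] t ->
  (forall k, count [pred m | k < logn p m] s = count [pred m | k < logn p m] t) ->
  perm_eq s t.
Proof.
move=> p_pr ps pt s_gt1 t_gt1 eq_count.
have count_split r k : all (pnat p) r ->
  count [pred m | k < logn p m] r
    = count_mem (p ^ k.+1) r + count [pred m | k.+1 < logn p m] r.
  elim: r => //= m r IHr /andP[pm /IHr->].
  have -> : (m == p ^ k.+1) = (logn p m == k.+1).
    by rewrite -{1}(part_pnat_id pm) p_part eqn_exp2l ?prime_gt1.
  by rewrite addnACA; congr (_ + _); rewrite eq_sym; case: (ltngtP k.+1).
apply/allP=> x; rewrite mem_cat => xst.
have px : p.-nat x by case/orP: xst; [move/(allP ps) | move/(allP pt)].
have x_gt1 : 1 < x by case/orP: xst; [move/(allP s_gt1) | move/(allP t_gt1)].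
have [k ->] : exists k, x = p ^ k.+1.
  have [k def_x] := p_natP px; rewrite def_x in x_gt1 *.
  by case: k x_gt1 {def_x} => // k _; exists k.
by rewrite /= -(eqn_add2r (count [pred m | k.+1 < logn p m] s)) {2}eq_count
  -!count_split ?eq_count.
Qed.

Import GroupScope.

Lemma psi'_isog (gT rT : finGroupType) (G : {group gT}) (H : {group rT}) :
  G \isog H -> psi' G = psi' H.
Proof.
case/isogP=> f injf <-; rewrite /psi' morphimEdom big_imset; last exact/injmP.
by apply: eq_bigr => x Gx; rewrite /= order_injm.
Qed.

Section AbelianPGroup.

Variables (p n : nat) (gT : finGroupType) (G : {group gT}).
Hypotheses (p_pr : prime p) (cGG : abelian G) (oG : #|G| = (p ^ n)%N).

Let pG : p.-group G.
Proof. by rewrite /pgroup oG pnatX pnat_id. Qed.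

Lemma mem_Ohm_abelian k x : x \in G -> (x \in 'Ohm_k(G)) = (logn p #[x] <= k).
Proof.
move=> Gx; rewrite (OhmEabelian pG) ?(abelianS (Ohm_sub k G)) // !inE Gx /=.
rewrite -order_dvdn -{1}(part_pnat_id (mem_p_elt pG Gx)) p_part.
by rewrite dvdn_Pexp2l ?prime_gt1.
Qed.

Lemma card_Ohm_logn k : #|'Ohm_k(G)| = (p ^ logn p #|'Ohm_k(G)|)%N.
Proof. by rewrite -p_part part_pnat_id //; apply: pgroupS (Ohm_sub k G) pG. Qed.

(** Strictness: any element of order above [p ^ k] has a power of order exactly [p ^ k.+1], which
    separates ['Ohm_k(G)] from ['Ohm_k.+1(G)]. *)
Lemma strict_until_logn_Ohm : strict_until n (fun k => logn p #|'Ohm_k(G)|).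
Proof.
move=> k.
have lnG : logn p #|G| = n by rewrite oG pfactorK.
have le_n j : logn p #|'Ohm_j(G)| <= n.
  by rewrite -lnG dvdn_leq_log // cardSg ?Ohm_sub.
have le_S : logn p #|'Ohm_k(G)| <= logn p #|'Ohm_k.+1(G)|.
  by rewrite dvdn_leq_log // cardSg ?Ohm_leq.
split=> // lt_n; rewrite ltn_neqAle le_S andbT; apply/eqP=> eq_ln.
have eqOhm : 'Ohm_k(G) = 'Ohm_k.+1(G).
  by apply/eqP; rewrite eqEcard Ohm_leq //= (card_Ohm_logn k.+1) -eq_ln -card_Ohm_logn.
suffices defG : 'Ohm_k(G) = G by rewrite defG lnG ltnn in lt_n.
apply/eqP; rewrite eqEsubset Ohm_sub; apply/subsetP=> x Gx.
rewrite mem_Ohm_abelian // leqNgt; apply/negP => lt_kx.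
pose y := x ^+ (p ^ (logn p #[x] - k.+1)).
have Gy : y \in G by rewrite groupX.
have ox : #[x] = (p ^ logn p #[x])%N.
  by rewrite -p_part part_pnat_id //; apply: mem_p_elt pG Gx.
have oy : logn p #[y] = k.+1.
  by rewrite (orderXexp _ ox) pfactorK // subKn.
have := mem_Ohm_abelian k.+1 Gy.
by rewrite -eqOhm mem_Ohm_abelian // oy ltnn leqnn.
Qed.

(** Double counting: each [x] lies in ['Ohm_k(G)] for exactly [N - logn p #[x]] indices [k < N]. The
    additive form avoids truncated subtraction. *)
Lemma logn_psi' N : n <= N ->
  logn p (psi' G) + \sum_(k < N) #|'Ohm_k(G)| = (N * #|G|)%N.
Proof.
move=> le_nN.
have -> : logn p (psi' G) = \sum_(x in G) logn p #[x].
  (* Positivity is carried through the induction because [lognM] needs nonzero factors. *)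
  rewrite /psi'; have [] // : 0 < \prod_(x in G) #[x] /\
      logn p (\prod_(x in G) #[x]) = \sum_(x in G) logn p #[x].
  elim/big_rec2: _ => [|x a b _ [b_gt0 <-]]; first by rewrite logn1.
  by rewrite muln_gt0 order_gt0 lognM.
have -> : \sum_(k < N) #|'Ohm_k(G)| = \sum_(x in G) \sum_(k < N) (logn p #[x] <= k).
  rewrite exchange_big; apply: eq_bigr => k _ /=.
  rewrite -sum1_card big_mkcond [RHS]big_mkcond; apply: eq_bigr => x _ /=.
  case Gx: (x \in G); first by rewrite mem_Ohm_abelian //; case: leqP.
  by rewrite (contraFF (subsetP (Ohm_sub k G) x) Gx).
rewrite -big_split mulnC -sum_nat_const; apply: eq_bigr => x Gx /=.
apply: sum_leq_ord; apply: leq_trans le_nN.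
by rewrite -(pfactorK n p_pr) -oG dvdn_leq_log ?cardG_gt0 ?order_dvdG.
Qed.

End AbelianPGroup.

(** The index of ['Ohm_k(G)] in ['Ohm_k.+1(G)] is [p] to the number of cyclic factors of order above
    [p ^ k], so these cardinals fix the abelian type. *)
Lemma isog_eq_card_Ohm (p : nat) (gT rT : finGroupType)
    (G : {group gT}) (H : {group rT}) :
  prime p -> p.-group G -> p.-group H -> abelian G -> abelian H ->
  (forall k, #|'Ohm_k(G)| = #|'Ohm_k(H)|) -> G \isog H.
Proof.
move=> p_pr pG pH cGG cHH eqOhm; rewrite eq_abelian_type_isog //.
have type_p (T : finGroupType) (K : {group T}) :
    p.-group K -> abelian K -> all (pnat p) (abelian_type K).
  move=> pK /abelian_structure[b defK <-]; apply/allP=> _ /mapP[x b_x ->].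
  apply: (mem_p_elt pK); rewrite -(bigdprodWY defK).
  by case/splitPr: b_x => b1 b2; rewrite mem_gen // big_cat big_cons !inE cycle_id orbT.
(* Abelian types are sorted in nonincreasing order, so equality up to permutation suffices. *)
apply/eqP/(@sorted_eq _ geq); rewrite ?abelian_type_sorted //.
- by move=> a b c /= le_ab le_ca; apply: leq_trans le_ca le_ab.
- by move=> a b; rewrite andbC -eqn_leq => /eqP.
apply: (perm_eq_count_logn p_pr); rewrite ?type_p ?abelian_type_gt1 // => k.
have [bG defG <-] := abelian_structure cGG.
have [bH defH <-] := abelian_structure cHH.
rewrite !count_map (count_logn_dprod_cycle p k defG).
rewrite (count_logn_dprod_cycle p k defH) -!divgS ?Ohm_leq //=.
by rewrite !eqOhm.
Qed.

Theorem corollaryD (p n : nat) (gT rT : finGroupType)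
    (G : {group gT}) (H : {group rT}) :
  prime p -> (0 < n)%N ->
  (p.-group G)%g -> (p.-group H)%g ->
  abelian G -> abelian H ->
  #|G| = (p ^ n)%N -> #|H| = (p ^ n)%N ->
  (G \isog H)%g <-> psi' G = psi' H.
Proof.
move=> p_pr _ pG pH cGG cHH oG oH; split=> [|eq_psi]; first exact: psi'_isog.
apply: (isog_eq_card_Ohm p_pr) => // k.
rewrite (card_Ohm_logn p_pr oG) (card_Ohm_logn p_pr oH); congr (p ^ _)%N.
(* The number of terms is [maxn n k.+1]: at least [n] for [logn_psi'], and large enough to include
   index [k]. *)
apply: (sum_expn_strict_until_inj (prime_gt1 p_pr)
  (strict_until_logn_Ohm p_pr cGG oG) (strict_until_logn_Ohm p_pr cHH oH) _
  (leq_maxr n k.+1)).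
under eq_bigr do rewrite -(card_Ohm_logn p_pr oG).
under [RHS]eq_bigr do rewrite -(card_Ohm_logn p_pr oH).
apply: (@addnI (logn p (psi' G))); rewrite (logn_psi' p_pr cGG oG) ?leq_maxl //.
by rewrite eq_psi (logn_psi' p_pr cHH oH) ?leq_maxl // oG oH.
Qed.
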